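(* Let $\mathcal{M}=\langle W,R,V\rangle$ be a relational model, let $w\in W$, and let $\varphi$ be a formula of sabotage logic $\mathcal{ML}(\langle\mathsf{sb}\rangle,\langle\mathsf{gsb}\rangle)$. Then $$\mathcal{M},w\models\varphi\quad\text{if and only if}\quad \mathcal{M},w\models(\varphi)'_{\emptyset},$$ where $(\varphi)'_\emptyset$ is the translation of $\varphi$ into the hybrid logic $\mathcal{HL}(\mathsf{E},\downarrow)$ defined in the context (taken with parameter $S=\emptyset$), and where on the right-hand side $\mathcal{M}$ is regarded as a hybrid model by letting the nominals denote arbitrary states of $W$.
   Context: Let $\mathsf{PROP}$ be a countably infinite set of propositional symbols and $\mathsf{NOM}$ a countably infinite set of nominals; formulas of sabotage logic contain no nominals. **Models.** A model is $\mathcal{M}=\langle W,R,V\rangle$ with $W\neq\emptyset$, $R\subseteq W\times W$, and $V$ assigning to each $p\in\mathsf{PROP}$ a subset $V(p)\subseteq W$. A hybrid model additionally has $V$ assigning to each nominal a singleton subset of $W$. For $(v,u)\in R$, $\mathcal{M}^-_{vu}=\langle W,R\setminus\{(v,u)\},V\rangle$. **Sabotage logic** $\mathcal{ML}(\langle\mathsf{sb}\rangle,\langle\mathsf{gsb}\rangle)$: formulas are $\bot\mid p\mid\neg\varphi\mid\varphi\wedge\psi\mid\Diamond\varphi\mid\langle\mathsf{sb}\rangle\varphi\mid\langle\mathsf{gsb}\rangle\varphi$ with $p\in\mathsf{PROP}$. Semantics: $\bot$, $p$ (true at $w$ iff $w\in V(p)$), $\neg$, $\wedge$ as usual; $\mathcal{M},w\models\Diamond\varphi$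 iff $\mathcal{M},v\models\varphi$ for some $v$ with $(w,v)\in R$; $\mathcal{M},w\models\langle\mathsf{sb}\rangle\varphi$ iff for some $v$ with $(w,v)\in R$, $\mathcal{M}^-_{wv},v\models\varphi$; $\mathcal{M},w\models\langle\mathsf{gsb}\rangle\varphi$ iff for some $(v,u)\in R$, $\mathcal{M}^-_{vu},w\models\varphi$. **Hybrid logic** $\mathcal{HL}(\mathsf{E},\downarrow)$: built from propositional symbols and nominals using $\bot,\neg,\wedge,\Diamond$, $\mathsf{E}$ and $\downarrow n.$ (for $n\in\mathsf{NOM}$). Semantics: $\bot$, $p$ (true at $w$ iff $w\in V(p)$), $\neg$, $\wedge$ have their usual meaning; $\mathcal{M},w\models\Diamond\varphi$ iff $\mathcal{M},v\models\varphi$ for some $v$ with $(w,v)\in R$; a nominal $n$ is true at $w$ iff $V(n)=\{w\}$; $\mathcal{M},w\models\mathsf{E}\varphi$ iff $\mathcal{M},v\models\varphi$ for some $v\in W$; $\langle W,R,V\rangle,w\models\,\downarrow n.\varphi$ iff $\langle W,R,V_n^w\rangle,w\models\varphi$, where $V_n^w$ agrees with $V$ except that $V_n^w(n)=\{w\}$. The satisfaction operator $n{:}\varphi$ (true iff $\varphi$ is true at the state denoted by $n$) abbreviates $\mathsf{E}(n\wedge\varphi)$. **Translation.** For finite $S\subseteq\mathsf{NOM}\times\mathsf{NOM}$ (with $nm$ shorthand for $(n,m)$ or $\{(n,m)\}$) define $$\begin{aligned} (\bot)'_S&=\bot,\quad (p)'_S=p,\quad (\neg\varphi)'_S=\neg(\varphi)'_S,\quad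 (\varphi\wedge\psi)'_S=(\varphi)'_S\wedge(\psi)'_S,\\ (\Diamond\varphi)'_S&=\ \downarrow n.\Diamond(\neg\mathsf{belongs}(n,S)\wedge(\varphi)'_S),\\ (\langle\mathsf{sb}\rangle\varphi)'_S&=\ \downarrow n.\Diamond(\neg\mathsf{belongs}(n,S)\wedge\downarrow m.(\varphi)'_{S\cup nm}),\\ (\langle\mathsf{gsb}\rangle\varphi)'_S&=\ \downarrow k.\mathsf{E}\downarrow n.\Diamond(\neg\mathsf{belongs}(n,S)\wedge\downarrow m.\,k{:}(\varphi)'_{S\cup nm}), \end{aligned}$$ where $n,m,k$ are pairwise distinct nominals not appearing in $S$, and $\mathsf{belongs}(n,S)=\bigvee_{(x,y)\in S}(y\wedge n{:}x)$ (the empty disjunction being $\bot$). The nominals of $(\varphi)'_\emptyset$ are all bound, so its truth value does not depend on the initial denotation of the nominals. *)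

(* Defs.v *)
From mathcomp Require Import all_boot finmap.
From mathcomp Require Import boolp classical_sets functions cardinality.

Local Open Scope classical_set_scope.

Definition countably_infinite (T : Type) : Prop :=
  ([set: T] #= [set: nat])%card.

Record model (PROP : Type) := Model {
  state :> Type;
  state_inhabited : inhabited state;
  acc : set (state * state);
  valuation : PROP -> set state }.

Arguments Model {PROP}.
Arguments state_inhabited {PROP}.
Arguments acc {PROP}.
Arguments valuation {PROP}.

(* The states of [del M v u] are, by conversion, those of [M]; this is what lets
   the semantics evaluate a formula at the same state in the modified model. *)
Definition del {PROP : Type} (M : model PROP) (v u : M) : model PROP :=
  Model M (state_inhabited M) (acc M `\ (v, u)) (valuation M).

Inductive ml (PROP : Type) : Type :=
| MLbot
| MLprop of PROP
| MLneg of ml PROP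
| MLand of ml PROP & ml PROP
| MLdia of ml PROP
| MLsb of ml PROP
| MLgsb of ml PROP.

Arguments MLbot {PROP}.
Arguments MLprop {PROP}.
Arguments MLneg {PROP}.
Arguments MLand {PROP}.
Arguments MLdia {PROP}.
Arguments MLsb {PROP}.
Arguments MLgsb {PROP}.

Fixpoint mlsat {PROP : Type} (phi : ml PROP) (M : model PROP) (w : M)
    {struct phi} : Prop :=
  match phi with
  | MLbot => False
  | MLprop p => valuation M p w
  | MLneg phi1 => ~ mlsat phi1 M w
  | MLand phi1 phi2 => mlsat phi1 M w /\ mlsat phi2 M w
  | MLdia phi1 => exists v : M, acc M (w, v) /\ mlsat phi1 M v
  | MLsb phi1 => exists v : M, acc M (w, v) /\ mlsat phi1 (del M w v) v
  | MLgsb phi1 =>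
      exists v u : M, acc M (v, u) /\ mlsat phi1 (del M v u) w
  end.

Record hmodel (PROP NOM : Type) := HModel {
  hbase :> model PROP;
  nomval : NOM -> set hbase;
  nomval_singleton : forall n, exists v, nomval n = [set v] }.

Arguments HModel {PROP NOM}.
Arguments nomval {PROP NOM}.
Arguments nomval_singleton {PROP NOM}.

Definition renom {NOM : eqType} {W : Type} (g : NOM -> set W) (n : NOM) (w : W)
  : NOM -> set W := fun x => if x == n then [set w] else g x.

Lemma renom_singleton {NOM : eqType} {W : Type} (g : NOM -> set W)
    (hg : forall x, exists v, g x = [set v]) (n : NOM) (w : W) (x : NOM) :
  exists v, renom g n w x = [set v].
Proof. by rewrite /renom; case: eqP => _ //; exists w. Qed.

Definition hrenom {PROP : Type} {NOM : eqType} (M : hmodel PROP NOM) (n : NOM)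
    (w : M) : hmodel PROP NOM :=
  HModel M (renom (nomval M) n w)
    (renom_singleton (nomval M) (nomval_singleton M) n w).

Inductive hl (PROP NOM : Type) : Type :=
| HLbot
| HLprop of PROP
| HLnom of NOM
| HLneg of hl PROP NOM
| HLand of hl PROP NOM & hl PROP NOM
| HLdia of hl PROP NOM
| HLE of hl PROP NOM
| HLdown of NOM & hl PROP NOM.

Arguments HLbot {PROP NOM}.
Arguments HLprop {PROP NOM}.
Arguments HLnom {PROP NOM}.
Arguments HLneg {PROP NOM}.
Arguments HLand {PROP NOM}.
Arguments HLdia {PROP NOM}.
Arguments HLE {PROP NOM}.
Arguments HLdown {PROP NOM}.

Fixpoint hlsat {PROP : Type} {NOM : eqType} (psi : hl PROP NOM)
    (M : hmodel PROP NOM) (w : M) {struct psi} : Prop :=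
  match psi with
  | HLbot => False
  | HLprop p => valuation M p w
  | HLnom n => nomval M n = [set w]
  | HLneg psi1 => ~ hlsat psi1 M w
  | HLand psi1 psi2 => hlsat psi1 M w /\ hlsat psi2 M w
  | HLdia psi1 => exists v : M, acc M (w, v) /\ hlsat psi1 M v
  | HLE psi1 => exists v : M, hlsat psi1 M v
  | HLdown n psi1 => hlsat psi1 (hrenom M n w) w
  end.

Definition HLor {PROP NOM : Type} (psi1 psi2 : hl PROP NOM) : hl PROP NOM :=
  HLneg (HLand (HLneg psi1) (HLneg psi2)).

Definition HLbigor {PROP NOM : Type} (s : seq (hl PROP NOM)) : hl PROP NOM :=
  foldr HLor HLbot s.

Definition HLat {PROP NOM : Type} (n : NOM) (psi : hl PROP NOM) : hl PROP NOM :=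
  HLE (HLand (HLnom n) psi).

(* The disjuncts are listed in the order of the canonical enumeration of S. *)
Definition belongs {PROP : Type} {NOM : choiceType} (n : NOM)
    (S : {fset NOM * NOM}) : hl PROP NOM :=
  HLbigor [seq HLand (HLnom xy.2) (HLat n (HLnom xy.1)) | xy <- enum_fset S].

Definition fresh {NOM : choiceType} (n : NOM) (S : {fset NOM * NOM}) : Prop :=
  forall x y, (x, y) \in S -> n <> x /\ n <> y.

(* [translation S phi psi]: psi is a value of (phi)'_S.  The fresh nominals are
   left unspecified by the clauses, hence a relation: at every occurrence any
   admissible choice is allowed. *)
Inductive translation {PROP : Type} {NOM : choiceType} :
    {fset NOM * NOM} -> ml PROP -> hl PROP NOM -> Prop :=
| tr_bot S : translation S MLbot HLbot
| tr_prop S p : translation S (MLprop p) (HLprop p)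
| tr_neg S phi psi :
    translation S phi psi -> translation S (MLneg phi) (HLneg psi)
| tr_and S phi1 phi2 psi1 psi2 :
    translation S phi1 psi1 -> translation S phi2 psi2 ->
    translation S (MLand phi1 phi2) (HLand psi1 psi2)
| tr_dia S phi psi n :
    fresh n S -> translation S phi psi ->
    translation S (MLdia phi)
      (HLdown n (HLdia (HLand (HLneg (belongs n S)) psi)))
| tr_sb S phi psi n m :
    fresh n S -> fresh m S -> n <> m ->
    translation ((n, m) |` S)%fset phi psi ->
    translation S (MLsb phi)
      (HLdown n (HLdia (HLand (HLneg (belongs n S)) (HLdown m psi))))
| tr_gsb S phi psi n m k :
    fresh n S -> fresh m S -> fresh k S -> n <> m -> n <> k -> m <> k ->
    translation ((n, m) |` S)%fset phi psi ->
    translation S (MLgsb phi)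
      (HLdown k (HLE (HLdown n (HLdia
         (HLand (HLneg (belongs n S)) (HLdown m (HLat k psi))))))).

Lemma exists_notin {NOM : choiceType} (hN : countably_infinite NOM)
    (A : {fset NOM}) : exists n, n \notin A.
Proof.
have infN : infinite_set [set: NOM].
  apply/infiniteP; move: hN; rewrite /countably_infinite card_eq_le.
  by case/andP.
have [n [_ nA]] := infinite_setN0 (infinite_setD infN (finite_fset A)).
by exists n; apply/negP.
Qed.

Lemma exists_fresh {NOM : choiceType} (hN : countably_infinite NOM)
    (S : {fset NOM * NOM}) (A : {fset NOM}) :
  exists n, fresh n S /\ n \notin A.
Proof.
have [n] := exists_notin hN
  (A `|` [fset xy.1 | xy in S] `|` [fset xy.2 | xy in S])%fset.
rewrite !inE !negb_or => /andP[/andP[nA n1] n2]; exists n; split=> // x y xyS.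
split=> nE; [move/negP: n1; apply|move/negP: n2; apply];
  by apply/imfsetP; exists (x, y).
Qed.

Lemma translation_total (PROP : Type) (NOM : choiceType)
    (hN : countably_infinite NOM) (phi : ml PROP) (S : {fset NOM * NOM}) :
  exists psi : hl PROP NOM, translation S phi psi.
Proof.
elim: phi S => [|p|f IH|f1 IH1 f2 IH2|f IH|f IH|f IH] S.
- by exists HLbot; constructor.
- by exists (HLprop p); constructor.
- by have [g ?] := IH S; eexists; constructor; eassumption.
- have [g1 ?] := IH1 S; have [g2 ?] := IH2 S.
  by eexists; constructor; eassumption.
- have [g ?] := IH S; have [n [? _]] := exists_fresh hN S fset0.
  by eexists; apply: (@tr_dia _ _ _ _ _ n); eassumption.
- have [n [? _]] := exists_fresh hN S fset0.
  have [m [? mn]] := exists_fresh hN S [fset n]%fset.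
  have [g ?] := IH ((n, m) |` S)%fset.
  eexists; apply: (@tr_sb _ _ _ _ _ n m); try eassumption.
  by move=> E; rewrite E inE eqxx in mn.
- have [n [? _]] := exists_fresh hN S fset0.
  have [m [? mn]] := exists_fresh hN S [fset n]%fset.
  have [k [? kn]] := exists_fresh hN S [fset n; m]%fset.
  have [g ?] := IH ((n, m) |` S)%fset.
  eexists; apply: (@tr_gsb _ _ _ _ _ n m k); try eassumption.
  + by move=> E; rewrite E inE eqxx in mn.
  + by move=> E; rewrite E !inE eqxx in kn.
  + by move=> E; rewrite E !inE eqxx orbT in kn.
Qed.

(* Main.v *)
Require Import Defs.
From mathcomp Require Import all_boot finmap.
From mathcomp Require Import boolp classical_sets functions cardinality.

(** Induction along the translation, generalized to an arbitrary [S]: when the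
    nominals in [S] denote the end points of the edges deleted so far, truth of
    [phi] in the sabotaged model coincides with truth of [(phi)'_S] in the
    original model.  Freshness ensures that binding further nominals does not
    change the set of edges that [S] denotes. *)

Local Open Scope classical_set_scope.

(** Taking a bare assignment [g] lets the edge sets before and after a rebinding be compared in one
    type. *)
Definition denoted_edges {NOM : choiceType} {W : Type} (g : NOM -> set W)
    (S : {fset NOM * NOM}) : set (W * W) :=
  [set e | exists x y, [/\ (x, y) \in S, g x = [set e.1] & g y = [set e.2]]].

Lemma renom_eq {NOM : eqType} {W : Type} (g : NOM -> set W) n w :
  renom g n w n = [set w].
Proof. by rewrite /renom eqxx. Qed.

Lemma renom_neq {NOM : eqType} {W : Type} (g : NOM -> set W) n w x :
  n <> x -> renom g n w x = g x.
Proof. by rewrite /renom; case: eqP => // ->. Qed.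

Lemma singleton_inj {T : Type} {x y : T} : [set x] = [set y] -> x = y.
Proof. by move=> /seteqP[/(_ x erefl)]. Qed.

Lemma denoted_edges0 {NOM : choiceType} {W : Type} (g : NOM -> set W) :
  denoted_edges g fset0 = set0.
Proof. by apply/seteqP; split=> // e [x [y []]]; rewrite inE. Qed.

Lemma denoted_edges_renom {NOM : choiceType} {W : Type} (g : NOM -> set W)
    n w S :
  fresh n S -> denoted_edges (renom g n w) S = denoted_edges g S.
Proof.
move=> nS; apply/seteqP; split=> e [x [y [xyS gx gy]]]; exists x, y;
  have [nx ny] := nS _ _ xyS; split=> //; move: gx gy;
  by rewrite !renom_neq.
Qed.

Lemma denoted_edgesU1 {NOM : choiceType} {W : Type} (g : NOM -> set W)
    n m v u S :
  g n = [set v] -> g m = [set u] ->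
  denoted_edges g ((n, m) |` S)%fset = (v, u) |` denoted_edges g S.
Proof.
move=> gn gm; apply/seteqP; split=> [[a b] [x [y []]]|[a b]].
  rewrite !inE => /orP[/eqP[-> ->]|xyS gx gy]; last by right; exists x, y.
  by rewrite gn gm => /= /singleton_inj -> /singleton_inj ->; left.
case=> [[-> ->]|[x [y [xyS gx gy]]]].
  by exists n, m; rewrite !inE eqxx.
by exists x, y; rewrite !inE xyS orbT.
Qed.

Lemma hlsat_bigor {PROP : Type} {NOM T : eqType} (f : T -> hl PROP NOM) s
    (M : hmodel PROP NOM) (w : M) :
  hlsat (HLbigor [seq f i | i <- s]) M w <->
  exists2 i, i \in s & hlsat (f i) M w.
Proof.
elim: s => [|i s IH] /=; first by split=> // -[].
(* [HLor] is a negated conjunction of negations, so extracting a true disjunct is classical. *)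
split=> [/not_andP[/contrapT fi|/contrapT/IH[j js fj]]|[j]].
- by exists i; rewrite ?mem_head.
- by exists j; rewrite // inE js orbT.
- by rewrite inE => /orP[/eqP->|js] fj [] // _; apply; apply/IH; exists j.
Qed.

(** A disjunct tests the target [y] at the current state and the source [x] at the state named [n],
    which [gn] forces to be [w]. *)
Lemma hlsat_belongs {PROP : Type} {NOM : choiceType} (n : NOM) S
    (M : hmodel PROP NOM) (w v : M) :
  nomval M n = [set w] ->
  hlsat (belongs n S) M v <-> denoted_edges (nomval M) S (w, v).
Proof.
move=> gn; rewrite /belongs; split=> [/hlsat_bigor[[x y] xyS /= [gy]]|].
  by case=> a []; rewrite gn => /singleton_inj <- gx; exists x, y.
case=> x [y [xyS gx gy]]; apply/hlsat_bigor; exists (x, y) => //=.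
by split=> //; exists w.
Qed.

(* The sabotaged model is built on the states of [M] itself, so that renaming
   nominals and deleting edges leave its type of states unchanged by
   conversion. *)
Lemma translation_sat {PROP : Type} {NOM : choiceType} S (phi : ml PROP)
    (psi : hl PROP NOM) :
  translation S phi psi -> forall (M : hmodel PROP NOM) (w : M) A,
  A = acc M `\` denoted_edges (nomval M) S ->
  mlsat phi (Model M (state_inhabited M) A (valuation M)) w <-> hlsat psi M w.
Proof.
(* The guard after each diamond restricts it to the edges that survive. *)
have notin_belongs n T (M : hmodel PROP NOM) (w v : M) A : fresh n T ->
    A = acc M `\` denoted_edges (nomval M) T ->
    A (w, v) <->
    acc M (w, v) /\ ~ hlsat (belongs n T) (hrenom M n w) v.
  move=> nT ->; have := @hlsat_belongs PROP NOM n T (hrenom M n w) w v.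
  rewrite /= denoted_edges_renom // => /(_ (renom_eq _ _ _)) E.
  by split=> -[? N]; split=> //; apply: contra_not N => /E.
(* The invariant is preserved: cutting [(w, v)] amounts to adding to [T] a pair of nominals naming
   its end points. Since [n <> m], binding [m] does not overwrite [n]. *)
have acc_del n m T (M : hmodel PROP NOM) (w v : M) A :
    fresh n T -> fresh m T -> n <> m ->
    A = acc M `\` denoted_edges (nomval M) T ->
    A `\ (w, v) = acc M `\`
      denoted_edges (renom (renom (nomval M) n w) m v) ((n, m) |` T)%fset.
  move=> nT mT nm ->.
  rewrite (@denoted_edgesU1 _ _ _ n m w v) ?renom_eq //; last first.
    by rewrite renom_neq ?renom_eq // => /esym.
  by rewrite !denoted_edges_renom // setDDl setUC.
elim=> {S phi psi}
  [S|S p|S phi psi _ IH|S phi1 phi2 psi1 psi2 _ IH1 _ IH2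
  |S phi psi n nS _ IH|S phi psi n m nS mS nm _ IH
  |S phi psi n m k nS mS kS nm nk mk _ IH] M w A AE //=.
- by split; apply: contra_not => /(IH _ _ _ AE).
- by split=> -[/(IH1 _ _ _ AE) ? /(IH2 _ _ _ AE)].
- have IHn v := IH (hrenom M n w) v A.
  rewrite /= denoted_edges_renom // in IHn.
  split=> [[v [/(notin_belongs n _ _ _ _ _ nS AE)[? ?] /(IHn _ AE) ?]]|].
    by exists v.
  move=> [v [? [? /(IHn _ AE) ?]]]; exists v; split=> //.
  exact/(notin_belongs n _ _ _ _ _ nS AE).
- have IHnm v := IH (hrenom (hrenom M n w) m v) v _
    (acc_del _ _ _ M w v _ nS mS nm AE).
  split=> [[v [/(notin_belongs n _ _ _ _ _ nS AE)[? ?] /IHnm ?]]|].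
    by exists v.
  move=> [v [? [? /IHnm ?]]]; exists v; split=> //.
  exact/(notin_belongs n _ _ _ _ _ nS AE).
- have AEk : A = acc M `\` denoted_edges (nomval (hrenom M k w)) S.
    by rewrite /= denoted_edges_renom.
  have IHk v u := IH (hrenom (hrenom (hrenom M k w) n v) m u) w _
    (acc_del _ _ _ (hrenom M k w) v u _ nS mS nm AEk).
  (* As [k] differs from [n] and [m], it still names the evaluation state once the edge is chosen,
     so the state picked by [HLat k] must be [w]. *)
  have kE v u : renom (renom (renom (nomval M) k w) n v) m u k = [set w].
    by rewrite renom_neq // renom_neq // renom_eq.
  split=> [[v [u [/(notin_belongs n _ (hrenom M k w) _ _ _ nS AEk)[? ?]]]]|].
    by move=> /IHk ?; exists v, u; split=> //; split=> //; exists w.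
  move=> [v [u [? [? [z []]]]]]; rewrite kE => /singleton_inj <- /IHk ?.
  exists v, u; split=> //.
  exact/(notin_belongs n _ (hrenom M k w) _ _ _ nS AEk).
Qed.

Theorem theorem1 (PROP : Type) (NOM : choiceType)
    (hPROP : countably_infinite PROP) (hNOM : countably_infinite NOM)
    (M : model PROP) (w : M) (phi : ml PROP)
    (psi : hl PROP NOM) (hpsi : translation fset0 phi psi)
    (g : NOM -> set M) (hg : forall n : NOM, exists v : M, g n = set1 v) :
  mlsat phi M w <-> hlsat psi (HModel M g hg) w.
Proof.
(* With [M] in constructor form, it matches by conversion the rebuilt model in [translation_sat]. *)
case: M w g hg => W inhW A V w g hg.
apply: (translation_sat _ _ _ hpsi (HModel (Model W inhW A V) g hg)).
by rewrite denoted_edges0 setD0.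
Qed.
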